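(* Let $\mathbf H \in \{\mathbf Z, \mathbf N\}$. Given $n \in \mathbf N^+$ and $\alpha \in [0,1]$, there exists $A \in \mathscr A_\infty$ such that $kA \in \mathrm{dom}(\mu)$ and $\mu(kA) = k\alpha/n$ for each $k \in \{1, \ldots, n\}$ and every quasi-density $\mu$ on $\mathbf H$.
   Context: $\mathbf N=\{0,1,2,\dots\}$, $\mathbf N^+=\{1,2,\dots\}$. For $X \subseteq \mathbf Z$ and $k,h\in\mathbf Z$, $k\cdot X+h:=\{kx+h : x\in X\}$. An arithmetic progression of $\mathbf H$ is a set $k\cdot\mathbf H+h$ with $k\in\mathbf N^+$, $h\in\mathbf H$. $\mathscr A_\infty$ is the family of subsets of $\mathbf H$ expressible as the union of a finite set and countably many arithmetic progressions of $\mathbf H$. For $X \subseteq \mathbf Z$, $kX$ denotes the $k$-fold sumset $\{x_1+\cdots+x_k : x_i\in X\}$. An upper quasi-density on $\mathbf H$ is a function $\mu^\ast:\mathcal P(\mathbf H)\to\mathbf R$ such that for all $X,Y\subseteq\mathbf H$: (1) $\mu^\ast(X)\le\mu^\ast(\mathbf H)=1$; (2) $\mu^\ast(X\cup Y)\le\mu^\ast(X)+\mu^\ast(Y)$; (3) $\mu^\ast(k\cdot X+h)=\frac1k\mu^\ast(X)$ for all $k\in\mathbf N^+$, $h\in\mathbf H$ (monotonicity is not required). Its conjugate is $\mu_\ast(X):=1-\mu^\ast(\mathbf H\setminus X)$. The quasi-density induced by $\mu^\ast$ is the restriction $\mu$ of $\mu^\ast$ to $\mathrm{dom}(\mu):=\{X\subseteq\mathbf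 H:\mu^\ast(X)=\mu_\ast(X)\}$; a quasi-density on $\mathbf H$ is any function arising this way. *)

(* Defs.v *)
From HB Require Import structures.
From mathcomp Require Import all_boot all_order all_algebra.
From mathcomp Require Import boolp classical_sets functions cardinality reals.
Set Implicit Arguments.
Unset Strict Implicit.
Unset Printing Implicit Defensive.
Import Order.TTheory GRing.Theory Num.Theory.
Local Open Scope classical_set_scope.
Local Open Scope ring_scope.

(* The ground set H is a set of integers, so that the cases H = Z and H = N
   are treated uniformly. *)
Definition Zset : set int := setT.
Definition Nset : set int := [set x | 0 <= x].

Definition dilate (k h : int) (X : set int) : set int :=
  [set k * x + h | x in X].

Definition sumset (k : nat) (X : set int) : set int :=
  [set s | exists x : 'I_k -> int, (forall i, X (x i)) /\ s = \sum_i x i].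

Definition arith_prog (H P : set int) : Prop :=
  exists (k : nat) (h : int), [/\ (0 < k)%N, H h & P = dilate k%:Z h H].

(* "Countable" includes finite and empty: a finite set belongs to this family. *)
Definition A_infty (H : set int) : set (set int) :=
  [set A | exists (F : set int) (PP : set (set int)),
     [/\ finite_set F, F `<=` H, countable PP,
         (forall P, PP P -> arith_prog H P) & A = F `|` \bigcup_(P in PP) P]].

(* A function on the power set of H is represented by a total function on
   [set int], of which only the values at subsets of H are used. *)
Definition upper_quasi_density (R : realType) (H : set int)
    (mu : set int -> R) : Prop :=
  [/\ mu H = 1,
      (forall X, X `<=` H -> mu X <= mu H),
      (forall X Y, X `<=` H -> Y `<=` H -> mu (X `|` Y) <= mu X + mu Y)
    & (forall X (k : nat) (h : int), X `<=` H -> (0 < k)%N -> H h ->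
         mu (dilate k%:Z h X) = k%:R^-1 * mu X)].

Definition conjugate (R : realType) (H : set int) (mu : set int -> R)
    (X : set int) : R :=
  1 - mu (H `\` X).

(* Real-valued partial functions on sets of integers: [None] means undefined. *)
Definition dom (R : realType) (mu : set int -> option R) : set (set int) :=
  [set X | exists v, mu X = Some v].

Definition induced (R : realType) (H : set int) (mu : set int -> R)
    (X : set int) : option R :=
  if `[< X `<=` H /\ mu X = conjugate H mu X >] then Some (mu X) else None.

Definition quasi_density (R : realType) (H : set int)
    (mu : set int -> option R) : Prop :=
  exists mustar : set int -> R,
    upper_quasi_density H mustar /\ mu = induced H mustar.

(* Main.v *)
(** Engel expansion: for 0 < a <= 1 put q = trunc(n/a) + 1 and a' = q a - n, so
    that 0 < a' <= a and a/n = (1 + a'/n)/q.  The set A(a) := q.H U (q.A(a') + 1)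
    contains 0, and for k <= n < q the k-fold sumset of A(a) contains all of H in
    the residue classes 0, ..., k - 1 modulo q, is q.(k A(a')) + k in the class k,
    and is empty in the remaining classes.  As q.X + h has upper quasi-density at
    most 1/q, unfolding this self-similarity bounds the upper quasi-densities of
    k A(a) and of its complement by ka/n and 1 - ka/n up to an error that is
    divided by q >= 2 at each level; monotonicity is never needed.  For a = 0 the
    set {0} works. *)
Require Import Defs.
From HB Require Import structures.
From mathcomp Require Import all_boot all_order all_algebra.
From mathcomp Require Import boolp classical_sets functions cardinality reals.
From mathcomp Require Import zify ring lra.
Set Implicit Arguments.
Unset Strict Implicit.
Unset Printing Implicit Defensive.
Import Order.TTheory GRing.Theory Num.Theory.
Local Open Scope classical_set_scope.
Local Open Scope ring_scope.

(** * Sumsets by recursion on the number of summands *)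

Lemma sumset0 (X : set int) : sumset 0 X = [set 0].
Proof.
apply/seteqP; split=> [z [x [_ ->]]|z ->] /=; first by rewrite big_ord0.
by exists (fun=> 0); split=> [[]//|]; rewrite big_ord0.
Qed.

Lemma sumsetS (k : nat) (X : set int) :
  sumset k.+1 X = [set x + y | x in X & y in sumset k X].
Proof.
apply/seteqP; split=> [z [x [Xx ->]]|z [x Xx [y [f [Xf ->]] <-]]].
  exists (x ord0) => //; exists (\sum_i x (lift ord0 i)); last first.
    by rewrite big_ord_recl.
  by exists (fun i => x (lift ord0 i)).
exists (fun i => if unlift ord0 i is Some j then f j else x); split.
  by move=> i; case: unliftP.
by rewrite big_ord_recl unlift_none; congr (_ + _); apply: eq_bigr => i _;
  rewrite liftK.
Qed.

(** * The ground set and the sumsets of two residue classes *)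

(** The facts shared by the integers and the naturals on which the proof rests. [cone_div] says that
    H meets the residue class i modulo q exactly in q.H + i. *)
Record cone (H : set int) : Prop := Cone {
  cone0 : H 0;
  coneD : forall x y, H x -> H y -> H (x + y);
  cone_nat : forall i : nat, H i%:Z;
  cone_div : forall (q i : nat) (y : int), (i < q)%N ->
    H (q%:Z * y + i%:Z) <-> H y }.

Lemma cone_ZN (H : set int) : H = Zset \/ H = Nset -> cone H.
Proof.
case=> ->; split=> //; rewrite /Nset /=.
- by move=> x y; lia.
- by move=> q i y iq; split; nia.
Qed.

Lemma sumset_sub (H X : set int) (k : nat) : cone H -> X `<=` H ->
  sumset k X `<=` H.
Proof.
move=> HC XH; elim: k => [|k IH]; first by rewrite sumset0 => _ ->; apply: cone0.
by rewrite sumsetS => _ [x Xx [y Sy <-]]; apply: (coneD HC); [apply: XH|apply: IH].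
Qed.

Lemma sumset_zero (X : set int) (k : nat) : X 0 -> sumset k X 0.
Proof.
by move=> X0; exists (fun=> 0); split=> //; rewrite big1.
Qed.

(** Let j count the summands taken from q.X + 1. If j < k, some summand ranges over all of q.H and
    absorbs the others, since X lies in H and contains 0; if j = k, only q.(kX) + k is reached. *)
Lemma sumset_two_classes (H X : set int) (q k : nat) : cone H -> X `<=` H ->
  X 0 ->
  sumset k (dilate q%:Z 0 H `|` dilate q%:Z 1 X) =
  [set z | exists (j : nat) (y : int),
     z = q%:Z * y + j%:Z /\ ((j < k)%N /\ H y \/ j = k /\ sumset k X y)].
Proof.
move=> HC XH X0; elim: k => [|k IH].
  rewrite !sumset0; apply/seteqP; split=> [z ->|z] /=.
    by exists 0%N, 0; split; [ring|right].
  by case=> j [y [-> [[//]|[-> ->]]]]; ring.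
rewrite sumsetS IH; apply/seteqP; split=> [z [x Ax [_ [j [y [-> Hy]]] <-]]|z].
  have yH : H y by case: Hy => [[]//|[_ /(sumset_sub HC XH)]].
  case: Ax => -[h Hh <-].
    exists j, (h + y); split; first by ring.
    left; split; last exact: (coneD HC).
    by case: Hy => [[/ltnW]//|[-> _]].
  exists j.+1, (h + y); split; first by rewrite intS; ring.
  case: Hy => [[jk _]|[-> Sy]].
    by left; split=> //; apply: (coneD HC) => //; apply: XH.
  by right; split=> //; rewrite sumsetS; exists h => //; exists y.
case=> j [y [-> [[jk Hy]|[-> ]]]].
  (* For j < k it suffices to add 0 to a sum of k terms. For j = k the first summand is q * y, and k
     copies of q * 0 + 1 supply the residue. *)
  move: jk; rewrite ltnS leq_eqVlt => /predU1P[->|jk]; last first.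
    exists 0; first by left; exists 0; [exact: cone0|ring].
    by exists (q%:Z * y + j%:Z); [exists j, y; split => //; left|ring].
  exists (q%:Z * y); first by left; exists y => //; ring.
  exists k%:Z; last by [].
  by exists k, 0; split; [ring|right; split=> //; exact: sumset_zero].
rewrite sumsetS => -[x Xx [w Sw <-]].
exists (q%:Z * x + 1); first by right; exists x.
exists (q%:Z * w + k%:Z); last by rewrite intS; ring.
by exists k, w; split=> //; right.
Qed.

Lemma sum_three_blocks (R : nzRingType) (q k : nat) (x y z : R) : (k < q)%N ->
  \sum_(i < q) (if (i < k)%N then x else if i == k :> nat then y else z) =
  x *+ k + y + z *+ (q - k.+1).
Proof.
move=> kq; rewrite -(big_mkord xpredT
  (fun i => if (i < k)%N then x else if i == k then y else z)).
rewrite (@big_cat_nat _ _ _ k) ?(ltnW kq) //= (@big_ltn _ _ _ k) // addrA.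
rewrite ltnn eqxx; congr (_ + _ + _).
- by rewrite -[in RHS](subn0 k) -sumr_const_nat; apply: eq_big_nat => i /= ->.
- rewrite -sumr_const_nat; apply: eq_big_nat => i /andP[ki _].
  by rewrite ltnNge (ltnW ki) /= gtn_eqF.
Qed.

(** * Upper quasi-densities and residue classes *)

Section UpperQuasiDensity.
Context (R : realType) (H : set int) (mu : set int -> R).
Hypotheses (HC : cone H) (muP : upper_quasi_density H mu).

(** The scaling axiom with factor 2 and shift 0 gives mu X = mu X / 2. This settles the empty set
    and {0} alike. *)
Lemma uqd_half0 (X : set int) : X `<=` H -> dilate 2 0 X = X -> mu X = 0.
Proof.
move=> XH dX; case: muP => _ _ _ /(_ X 2%N 0 XH isT (cone0 HC)).
by rewrite dX; lra.
Qed.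

Lemma uqd_set0 : mu set0 = 0.
Proof. by apply: uqd_half0; [exact: sub0set|exact: image_set0]. Qed.

Lemma uqd_zero : mu [set 0] = 0.
Proof.
by apply: uqd_half0 => [_ ->|]; [exact: cone0|rewrite /dilate image_set1].
Qed.

Lemma uqd_le1 (X : set int) : X `<=` H -> mu X <= 1.
Proof. by case: muP => <- + _ _; apply. Qed.

(** The part of X in the class i modulo q, rescaled to a subset of H, so that the scaling axiom
    applies to it. *)
Definition residue_section (q i : nat) (X : set int) : set int :=
  [set y | H y /\ X (q%:Z * y + i%:Z)].

Lemma uqd_le_sections (q : nat) (X : set int) : (0 < q)%N -> X `<=` H ->
  mu X <= q%:R^-1 * \sum_(i < q) mu (residue_section q i X).
Proof.
move=> q0 XH; case: (muP) => _ _ muU muD.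
have secH i : residue_section q i X `<=` H by move=> y [].
(* [P m] is the part of X in the classes 0, ..., m - 1; subadditivity is applied one class at a
   time. *)
pose P m := [set x | exists (i : nat) (y : int),
  [/\ (i < m)%N, x = q%:Z * y + i%:Z & residue_section q i X y]].
have PE m : P m.+1 = P m `|` dilate q%:Z m%:Z (residue_section q m X).
  apply/seteqP; split=> [x [i [y [im -> Xy]]]|x [[i [y [im -> Xy]]]|[y Xy <-]]].
  - move: im; rewrite ltnS leq_eqVlt => /predU1P[im|im]; last by left; exists i, y.
    by right; exists y; rewrite -im.
  - by exists i, y; split=> //; exact: ltnW.
  - by exists m, y.
have PX : P q = X.
  apply/seteqP; split=> [x [i [y [_ -> []]]]//|x Xx].
  have qn0 : q%:Z != 0 by lia.
  have [i iE] : exists i : nat, (x %% q%:Z)%Z = i%:Z.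
    by exists `|(x %% q%:Z)%Z|%N; rewrite gez0_abs // modz_ge0.
  have iq : (i < q)%N by rewrite -ltz_nat -iE ltz_pmod.
  have xE : x = q%:Z * (x %/ q%:Z)%Z + i%:Z by rewrite mulrC -iE -divz_eq.
  exists i, (x %/ q%:Z)%Z; split=> //; split; last by rewrite -xE.
  by apply/(cone_div HC (x %/ q%:Z)%Z iq); rewrite -xE; exact: XH.
have le_m m : (m <= q)%N ->
    mu (P m) <= q%:R^-1 * \sum_(i < m) mu (residue_section q i X).
  elim: m => [_|m IH mq].
    rewrite big_ord0 mulr0 (_ : P 0%N = set0) ?uqd_set0 //.
    by apply/seteqP; split=> // x [i [y []]].
  rewrite PE big_ord_recr /= mulrDr -(muD _ _ m%:Z) //; last exact: cone_nat.
  apply: le_trans (muU _ _ _ _) _.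
  - by move=> x [i [y [im -> [yH _]]]]; apply/(cone_div HC) => //; lia.
  - by move=> _ [y [yH _] <-]; apply/(cone_div HC).
  - by rewrite lerD2r IH // ltnW.
by rewrite -{1}PX le_m.
Qed.

Lemma residue_section_setD (q i : nat) (X : set int) : (i < q)%N ->
  residue_section q i (H `\` X) = H `\` residue_section q i X.
Proof.
move=> iq; apply/seteqP; split=> y [Hy].
  by case=> _ nX; split=> // -[].
by move=> nX; split=> //; split; [exact/(cone_div HC)|move=> ?; exact: nX].
Qed.

(** Subadditivity gives 1 <= mu X + mu (H \ X), so two upper bounds with sum 1 must both be
    attained. *)
Lemma induced_value (X : set int) (b : R) : X `<=` H ->
  mu X <= b -> mu (H `\` X) <= 1 - b -> induced H mu X = Some b.
Proof.
move=> XH leb leNb; case: (muP) => muH _ muU _.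
have := muU _ (H `\` X) XH (@subDsetl _ _ _); rewrite setDUK // muH => le1.
have muX : mu X = b by apply/le_anti/andP; split=> //; lra.
rewrite /induced; case: asboolP => [_|[]]; first by rewrite muX.
by split=> //; rewrite /conjugate; lra.
Qed.

End UpperQuasiDensity.

(** * The Engel expansion and the set built from it *)

Section Engel.
Context (R : realType) (n : nat).

(** For a > 0 this is the least q with q a > n. Taking the integer part plus one, rather than the
    ceiling, keeps the remainder positive even when n / a is an integer, so the expansion never
    stops. *)
Definition engel_digit (a : R) : nat := (Num.truncn (n%:R / a)).+1.

Definition engel_rest (a : R) : R := (engel_digit a)%:R * a - n%:R.

Lemma engel_rest_bounds (a : R) : 0 < a <= 1 -> 0 < engel_rest a <= 1.
Proof.
move=> /andP[a0 a1]; rewrite /engel_rest /engel_digit.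
have lt_na := truncnS_gt (n%:R / a).
have le_na : (Num.truncn (n%:R / a))%:R <= n%:R / a.
  by rewrite truncn_le divr_ge0 // ltW.
move: lt_na le_na; rewrite ltr_pdivrMr // ler_pdivlMr // -natr1 mulrDl => *.
by apply/andP; split; lra.
Qed.

Lemma engel_digit_gt (a : R) : 0 < a <= 1 -> (n < engel_digit a)%N.
Proof.
move=> /andP[a0 a1]; rewrite ltnS truncn_ge_nat.
  by rewrite ler_pdivlMr // ler_piMr.
by rewrite divr_ge0 // ltW.
Qed.

(** The least solution of A(a) = q.H U (q.A(a') + 1). The real a is an index because it changes to
    a' in the recursion. *)
Inductive engel_set (H : set int) : R -> int -> Prop :=
| engel_full a x : H x -> engel_set H a ((engel_digit a)%:Z * x)
| engel_rec a x : engel_set H (engel_rest a) x ->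
    engel_set H a ((engel_digit a)%:Z * x + 1).

Lemma engel_setE (H : set int) (a : R) :
  engel_set H a = dilate (engel_digit a)%:Z 0 H `|`
                  dilate (engel_digit a)%:Z 1 (engel_set H (engel_rest a)).
Proof.
apply/seteqP; split=> x.
- case=> {}a {}x Hx; [left|right]; exists x => //; exact: addr0.
- by case=> -[y Hy <-]; [rewrite addr0; exact: engel_full|exact: engel_rec].
Qed.

Variable H : set int.
Hypothesis HC : cone H.

Lemma engel_set_zero (a : R) : engel_set H a 0.
Proof. by rewrite -(mulr0 (engel_digit a)%:Z); apply/engel_full/(cone0 HC). Qed.

Hypothesis n0 : (0 < n)%N.

Lemma engel_set_sub (a : R) : 0 < a <= 1 -> engel_set H a `<=` H.
Proof.
move=> a01 x Ax; elim: Ax a01 => {}a {}x.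
  by move=> Hx _; rewrite -[X in H X]addr0; apply/(cone_div HC (i := 0)).
move=> _ IH a01; apply/(cone_div HC (i := 1)); last exact/IH/engel_rest_bounds.
exact: leq_ltn_trans n0 (engel_digit_gt a01).
Qed.

(** Membership is reached after finitely many uses of [engel_rec]. Composing the maps y -> q y + 1
    met on the way with the last q.H gives a progression through x inside the set. *)
Lemma engel_set_ap (a : R) (x : int) : 0 < a <= 1 -> engel_set H a x ->
  exists2 P, arith_prog H P & P x /\ P `<=` engel_set H a.
Proof.
move=> a01 Ax; elim: Ax a01 => {}a {}x.
  move=> Hx a01; exists (dilate (engel_digit a)%:Z 0 H).
    by exists (engel_digit a), 0; split=> //; exact: cone0.
  split; first by exists x => //; exact: addr0.
  by rewrite engel_setE; exact: subsetUl.
move=> _ IH a01; have [P [k [h [k0 Hh PE]]] [Px PA]] := IH (engel_rest_bounds a01).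
have q1 : (1 < engel_digit a)%N by exact: leq_ltn_trans n0 (engel_digit_gt a01).
exists (dilate (engel_digit a)%:Z 1 P).
  exists (engel_digit a * k)%N, ((engel_digit a)%:Z * h + 1); split.
  - by rewrite muln_gt0 k0.
  - by apply/(cone_div HC (i := 1)).
  - rewrite PE /dilate image_comp; apply: eq_imagel => y _ /=.
    by rewrite PoszM; ring.
split; first by exists x.
by rewrite engel_setE => _ [y Py <-]; right; exists y => //; exact: PA.
Qed.

Lemma engel_set_A_infty (a : R) : 0 < a <= 1 -> A_infty H (engel_set H a).
Proof.
(* The family of all progressions contained in the set is countable, being parametrised by pairs in
   nat * int. *)
move=> a01; exists set0, [set P | arith_prog H P /\ P `<=` engel_set H a]; split.
- exact: finite_set0.
- exact: sub0set.
- pose ap (kh : nat * int) := dilate kh.1%:Z kh.2 H.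
  apply: (@sub_countable _ _ _ (ap @` setT)).
    by apply: subset_card_le => P [[k [h [_ _ ->]]] _]; exists (k, h).
  exact: sub_countable (card_image_le _ _) (countableP _).
- by move=> P [].
- rewrite set0U; apply/seteqP; split=> x.
    by move=> /(engel_set_ap a01)[P Pap [Px PA]]; exists P.
  by case=> P [_ PA] /PA.
Qed.

(** * Upper quasi-densities of the k-fold sumsets and of their complements *)

Variables (k : nat) (kn : (k <= n)%N).

Lemma residue_section_engel (a : R) (i : nat) : 0 < a <= 1 ->
    (i < engel_digit a)%N ->
  residue_section H (engel_digit a) i (sumset k (engel_set H a)) =
  if (i < k)%N then H
  else if i == k then sumset k (engel_set H (engel_rest a)) else set0.
Proof.
move=> a01 iq; have nq := engel_digit_gt a01.
have a'01 := engel_rest_bounds a01; have AH := engel_set_sub a'01.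
rewrite engel_setE (sumset_two_classes _ _ HC AH (engel_set_zero _)).
(* As k <= n < q, the indices 0, ..., k are distinct residues modulo q, so the classes in the sumset
   do not wrap around. *)
have uniq_class (j : nat) (y z : int) : (j <= k)%N ->
    (engel_digit a)%:Z * y + i%:Z = (engel_digit a)%:Z * z + j%:Z -> i = j /\ y = z.
  move=> jk E; have ij : i = j.
    have := congr1 (fun w => (w %% (engel_digit a)%:Z)%Z) E.
    rewrite ![(engel_digit a)%:Z * _]mulrC !modzMDl !modz_small //; first by case.
    by lia.
  split=> //; move: E; rewrite ij => /addIr; apply: mulfI; lia.
apply/seteqP; split=> y.
  case=> Hy [j [z [yz Hz]]].
  have jk : (j <= k)%N by case: Hz => -[]; lia.
  have [-> ->] := uniq_class _ _ _ jk yz.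
  by case: Hz => -[]; [move=> ->|move=> ->; rewrite ltnn eqxx].
case: ltnP => [ik Hy|ki].
  by split=> //; exists i, y; split=> //; left.
case: eqP => // -> Sy; split; first exact: sumset_sub HC AH _ Sy.
by exists k, y; split=> //; right.
Qed.

(** Induction on the depth d, for all a at once since a becomes a'. At depth 0 the error is 1 and
    both bounds follow from mu <= 1 and 0 <= ka/n <= 1. *)
Lemma uqd_engel_approx (mu : set int -> R) (d : nat) (a : R) :
  upper_quasi_density H mu -> 0 < a <= 1 ->
  mu (sumset k (engel_set H a)) <= k%:R * a / n%:R + 2%:R ^- d /\
  mu (H `\` sumset k (engel_set H a)) <= 1 - k%:R * a / n%:R + 2%:R ^- d.
Proof.
move=> muP; have nR0 : 0 < n%:R :> R by rewrite ltr0n.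
have kaH b : 0 < b <= 1 -> sumset k (engel_set H b) `<=` H.
  by move=> b01; exact: sumset_sub HC (engel_set_sub b01).
elim: d a => [|d IH] a a01.
  have S1 := uqd_le1 muP (kaH a a01).
  have C1 := uqd_le1 muP (@subDsetl _ H (sumset k (engel_set H a))).
  have kR0 : 0 <= k%:R :> R by [].
  have knR : k%:R <= n%:R :> R by rewrite ler_nat.
  have ka0 : 0 <= k%:R * a / n%:R by rewrite divr_ge0 ?mulr_ge0 //; lra.
  have ka1 : k%:R * a / n%:R <= 1 by rewrite ler_pdivrMr //; nra.
  by rewrite expr0 invr1; split; lra.
have nq := engel_digit_gt a01; have q0 : (0 < engel_digit a)%N by [].
have [IHS IHC] := IH _ (engel_rest_bounds a01).
have qR0 : 0 < (engel_digit a)%:R :> R by rewrite ltr0n.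
have qR2 : 2 <= (engel_digit a)%:R :> R by rewrite ler_nat; lia.
have e0 : 0 < (2%:R ^- d : R) by rewrite invr_gt0 exprn_gt0.
have eS : 2%:R ^- d.+1 = 2%:R ^- d / 2 :> R by rewrite exprS invfM mulrC.
have restE : k%:R * engel_rest a / n%:R =
    (engel_digit a)%:R * (k%:R * a / n%:R) - k%:R.
  by rewrite /engel_rest; field; rewrite lt0r_neq0.
have kq : (k < engel_digit a)%N by exact: leq_ltn_trans nq.
have muH : mu H = 1 by case: muP.
have mu0 := uqd_set0 HC muP.
have qkR : (engel_digit a - k.+1)%:R = (engel_digit a)%:R - k%:R - 1 :> R.
  by rewrite natrB // -natr1; ring.
rewrite restE in IHS IHC; rewrite eS.
split.
(* The sections add up to at most k + (q ka/n - k) + 2^-d. Division by q >= 2 leaves ka/n and at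
   least halves the error. *)
- apply: le_trans (uqd_le_sections HC muP q0 (kaH a a01)) _.
  under eq_bigr => i _ do rewrite residue_section_engel // !(fun_if mu) muH mu0.
  by rewrite sum_three_blocks // ler_pdivrMl // mul0rn; nra.
(* In the complement the first k sections are empty and the last q - k - 1 are all of H, so the sum
   is at most (1 - q ka/n + k + 2^-d) + (q - k - 1) = q (1 - ka/n) + 2^-d. *)
- apply: le_trans (uqd_le_sections HC muP q0 (@subDsetl _ _ _)) _.
  under eq_bigr => i _ do
    rewrite (residue_section_setD HC) // residue_section_engel //
      !(fun_if (fun Y => mu (H `\` Y))) setDv setD0 muH mu0.
  by rewrite sum_three_blocks // ler_pdivrMl // mul0rn qkR; nra.
Qed.

End Engel.

(** * Passage to the limit and conclusion *)

Lemma le_add_half_exp (R : realType) (x y : R) :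
  (forall d, x <= y + 2%:R ^- d) -> x <= y.
Proof.
move=> le_xy; rewrite leNgt; apply/negP => yx.
have xy0 : 0 < x - y by rewrite subr_gt0.
(* The Archimedean property provides d with 2^d > 1 / (x - y). *)
have := @Num.Theory.upper_nthrootP R (x - y)^-1 _ (leqnn _).
set d := Num.bound _ => lt_d; have := le_xy d.
have : (2%:R ^- d : R) < x - y by rewrite invf_plt // posrE exprn_gt0.
lra.
Qed.

Lemma sumset_singleton0 (k : nat) : sumset k [set 0] = [set 0].
Proof.
elim: k => [|k IH]; first exact: sumset0.
rewrite sumsetS IH; apply/seteqP; split=> [_ [_ -> [_ -> <-]]|_ ->] //=.
by exists 0 => //; exists 0.
Qed.

Theorem theorem3p1 (R : realType) (H : set int) (hH : H = Zset \/ H = Nset)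
    (n : nat) (hn : (0 < n)%N) (alpha : R) (halpha : 0 <= alpha <= 1) :
  exists A : set int, A_infty H A /\
    forall (k : nat) (mu : set int -> option R),
      (1 <= k <= n)%N -> quasi_density H mu ->
      dom mu (sumset k A) /\ mu (sumset k A) = Some (k%:R * alpha / n%:R).
Proof.
have HC := cone_ZN hH.
(* The value 0 is treated apart: with n / 0 = 0 by convention, [engel_digit] would be 1 and
   [engel_rest] would be -n. *)
have [alpha0|alpha_neq0] := eqVneq alpha 0.
  have zH : [set 0] `<=` H by move=> _ ->; exact: cone0.
  exists [set 0]; split.
    exists [set 0], set0; split=> //.
    by rewrite bigcup_set0 setU0.
  move=> k mu _ [mustar [muP ->]]; rewrite sumset_singleton0 alpha0 mulr0 mul0r.
  have val : induced H mustar [set 0] = Some 0.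
    apply: induced_value => //; first by rewrite (uqd_zero HC muP).
    by rewrite subr0; apply: (uqd_le1 muP); exact: subDsetl.
  by split=> //; exists 0.
have a01 : 0 < alpha <= 1 by case/andP: halpha => a0 ->; rewrite lt0r alpha_neq0 a0.
exists (engel_set n H alpha); split; first exact: engel_set_A_infty.
move=> k mu /andP[_ kn] [mustar [muP ->]].
have val : induced H mustar (sumset k (engel_set n H alpha)) =
    Some (k%:R * alpha / n%:R).
  apply: induced_value => //.
  - exact: sumset_sub HC (engel_set_sub HC hn a01).
  - by apply: le_add_half_exp => d; case: (uqd_engel_approx HC hn kn d muP a01).
  - by apply: le_add_half_exp => d; case: (uqd_engel_approx HC hn kn d muP a01).
by split=> //; exists (k%:R * alpha / n%:R).
Qed.
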